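(* A van Rees quasigroup (of finite order $n$) or a van Rees latin square (of order $n$) has order $n\equiv 3 \pmod 6$.
   Context: A quasigroup is a set with a binary operation whose left translations $y\mapsto xy$ and right translations $y\mapsto yx$ are all bijections; a loop is a quasigroup with a two-sided neutral element $\varepsilon$. Quasigroups $(Q,\cdot)$ and $(P,\circ)$ are isotopic if there are bijections $\alpha,\beta,\gamma:Q\to P$ with $\alpha(x)\circ\beta(y)=\gamma(x\cdot y)$ for all $x,y\in Q$. A loop has exponent $3$ if it satisfies $xx\cdot x=x\cdot xx=\varepsilon$ for all $x$. A van Rees quasigroup is a quasigroup $Q$ such that every loop isotopic to $Q$ has exponent $3$. A subsquare of order $k$ of a latin square is a $k\times k$ submatrix (not necessarily on contiguous rows or columns) that is itself a latin square. A van Rees latin square is a latin square of (finite) order $n$ having exactly $n^2(n-1)/18$ subsquares of order $3$.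
   Formalization: The order n is assumed to be greater than 1: the one-element quasigroup and the 1×1 latin square satisfy the van Rees definitions (as do the empty ones, n = 0), but their order is not congruent to 3 mod 6. *)

(* Defs.v *)
(* Mathematical Components. *)
From mathcomp Require Import all_boot all_algebra.

Set Implicit Arguments.
Unset Strict Implicit.
Unset Printing Implicit Defensive.

Definition quasigroup (Q : Type) (op : Q -> Q -> Q) : Prop :=
  (forall x, bijective (fun y => op x y)) /\
  (forall x, bijective (fun y => op y x)).

Definition loop (Q : Type) (op : Q -> Q -> Q) (e : Q) : Prop :=
  [/\ quasigroup op, left_id e op & right_id e op].

Definition isotopic (Q P : Type) (opQ : Q -> Q -> Q) (opP : P -> P -> P) :
    Prop :=
  exists (alpha beta gamma : Q -> P),
    [/\ bijective alpha, bijective beta, bijective gamma &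
        forall x y, opP (alpha x) (beta y) = gamma (opQ x y)].

Definition exponent3 (Q : Type) (op : Q -> Q -> Q) (e : Q) : Prop :=
  forall x, op (op x x) x = e /\ op x (op x x) = e.

Definition van_rees_quasigroup (Q : Type) (op : Q -> Q -> Q) : Prop :=
  quasigroup op /\
  forall (P : Type) (opP : P -> P -> P) (e : P),
    loop opP e -> isotopic op opP -> exponent3 opP e.

(* The ambient type S may contain unused symbols, so that a submatrix, which
   keeps the type S, can itself be a latin square: exactly n symbols occur, each
   of them once in every row and once in every column. *)
Definition symbols (S : finType) (n : nat) (A : 'M[S]_n) : {set S} :=
  [set A i j | i : 'I_n, j : 'I_n].

Definition latin_square (S : finType) (n : nat) (A : 'M[S]_n) : bool :=
  [&& #|symbols A| == n,
      [forall i, forall s in symbols A, #|[set j | A i j == s]| == 1] &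
      [forall j, forall s in symbols A, #|[set i | A i j == s]| == 1]].

Definition increasing (k n : nat) (f : {ffun 'I_k -> 'I_n}) : bool :=
  [forall i : 'I_k, forall j : 'I_k, (i < j) ==> (f i < f j)].

(* A k x k submatrix is given by the increasing enumerations of the rows and of
   the columns it retains; subsquares are counted by position. *)
Definition subsquares (k : nat) (S : finType) (n : nat) (L : 'M[S]_n) :
    {set {ffun 'I_k -> 'I_n} * {ffun 'I_k -> 'I_n}} :=
  [set fg | [&& increasing fg.1, increasing fg.2 &
                latin_square (mxsub fg.1 fg.2 L)]].

(* The number of subsquares is n^2 (n - 1) / 18 as a rational number; truncated
   division would be wrong (it is 0 for n = 2). *)
Definition van_rees_latin_square (S : finType) (n : nat) (L : 'M[S]_n) : Prop :=
  latin_square L /\ 18 * #|subsquares 3 L| = n ^ 2 * (n - 1).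

(* Main.v *)
(** In an order-3 subsquare, a row r and two columns c1, c2 determine everything
    else: the row r' carrying M r c2 in column c1, the column c3 carrying
    M r' c2 in row r, and the row r'' carrying M r c3 in column c1.  In a
    van Rees quasigroup, the exponent 3 law in the loop isotope with neutral
    element M r c1 provides such a completion for all r and c1 <> c2.  In a
    van Rees latin square, each triple (r, c1, c2) lies in at most one subsquare
    and each subsquare contains 18 of the n^2 (n - 1) triples, so that the
    count n^2 (n - 1) / 18 forces every triple to lie in one.
    For fixed r and c1, the map c2 |-> c3 is then an involution whose only fixed
    point is c1, so n is odd; for fixed c1 and c2, the map r |-> r' is a
    permutation all of whose cycles have length 3, so 3 divides n. *)

Require Import Defs.
From mathcomp Require Import all_boot all_algebra.

Set Implicit Arguments.
Unset Strict Implicit.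
Unset Printing Implicit Defensive.

(** If row [r] reads [x y z] in columns [c1], [c2], [c3], then row [r'] reads [y z _] and row [r'']
    reads [z x y], the blank being left open. *)
Definition completes3 (R C S : Type) (M : R -> C -> S)
    (r : R) (c1 c2 : C) (r' r'' : R) (c3 : C) : Prop :=
  [/\ M r' c1 = M r c2, M r' c2 = M r c3, M r'' c1 = M r c3,
      M r'' c2 = M r c1 & M r'' c3 = M r c2].

(** * Divisibility by 2 and 3 from completions *)

Section Completion.

Variables (R C : finType) (S : Type) (M : R -> C -> S).
Hypothesis row_inj : forall r, injective (M r).
Hypothesis col_inj : forall c, injective (M^~ c).

Lemma completes3_uniq r c1 c2 r' r'' c3 :
    c1 != c2 -> completes3 M r c1 c2 r' r'' c3 ->
  uniq [:: r; r'; r''] /\ uniq [:: c1; c2; c3].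
Proof.
move=> ne [e1 e2 e3 e4 e5].
have n1 : r != r'.
  by apply: contraNneq ne => er; rewrite -er in e1; rewrite (row_inj e1).
have n2 : r != r''.
  by apply: contraNneq ne => er; rewrite -er in e4; rewrite (row_inj e4).
have n3 : c2 != c3.
  by apply: contraNneq n1 => ec; rewrite -ec in e2; rewrite (col_inj e2).
have n4 : c1 != c3.
  by apply: contraNneq n2 => ec; rewrite -ec in e3; rewrite (col_inj e3).
have n5 : r' != r''.
  by apply: contraNneq n3 => er; apply/eqP/(@row_inj r); rewrite -e1 -e3 er.
by rewrite /= !inE !negb_or n1 n2 n3 n4 n5 ne.
Qed.

Lemma completes3_inj r c1 c2 r1' r1'' c3 r2' r2'' d3 :
    completes3 M r c1 c2 r1' r1'' c3 -> completes3 M r c1 c2 r2' r2'' d3 ->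
  [/\ r1' = r2', r1'' = r2'' & c3 = d3].
Proof.
case=> [a1 a2 a3 _ _] [b1 b2 b3 _ _].
have er : r1' = r2' by apply: (@col_inj c1); rewrite a1 b1.
have ec : c3 = d3 by apply: (@row_inj r); rewrite -a2 -b2 er.
by split=> //; apply: (@col_inj c1); rewrite a3 b3 ec.
Qed.

Hypothesis completion : forall r c1 c2, c1 != c2 ->
  exists r' r'' c3, completes3 M r c1 c2 r' r'' c3.

Lemma dvd3_card_rows (c1 c2 : C) : c1 != c2 -> 3 %| #|R|.
Proof.
move=> ne.
have [s sP] : exists s : R -> R, forall r, M (s r) c1 = M r c2.
  apply: (@fin_all_exists _ _ (fun r r' => M r' c1 = M r c2)) => r.
  by have [r' [_ [_ [e _ _ _ _]]]] := completion r ne; exists r'.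
have s_inj : injective s.
  by move=> x y exy; apply: (@col_inj c2); rewrite -!sP exy.
(* The cycle is [r], [r'], [r'']: in column [c1], row [r''] carries [M r' c2], and [M r'' c2] equals
   [M r c1], which leads back to [r]. *)
have order_s r : order s r = 3.
  have [r' [r'' [c3 comp]]] := completion r ne.
  have [unr _] := completes3_uniq ne comp.
  have [e1 e2 e3 e4 _] := comp.
  have s1 : s r = r' by apply: (@col_inj c1); rewrite sP e1.
  have s2 : s r' = r'' by apply: (@col_inj c1); rewrite sP e2 e3.
  have s3 : s r'' = r by apply: (@col_inj c1); rewrite sP e4.
  by rewrite (@order_cycle _ s [:: r; r'; r'']) ?inE ?eqxx //= s1 s2 s3 !eqxx.
rewrite -(@fcard_order_set _ s s_inj 3 R) ?dvdn_mull //.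
by apply/subsetP => r _; rewrite inE order_s.
Qed.

Lemma odd_card_columns (r : R) (c : C) : odd #|C|.
Proof.
pose T c2 c3 := exists r', M r' c = M r c2 /\ M r' c2 = M r c3.
(* At [c] no completion is available, so [f] is made total by fixing [c]. *)
have [f fP] : exists f : C -> C,
    forall x, if x == c then f x = c else T x (f x).
  apply: (@fin_all_exists _ _ (fun x y => if x == c then y = c else T x y)).
  move=> x; case: eqVneq => [_|ne]; first by exists c.
  rewrite eq_sym in ne; have [r' [_ [c3 [e1 e2 _ _ _]]]] := completion r ne.
  by exists c3, r'.
have Tinj x y z : T x y -> T x z -> y = z.
  move=> [r1 [a1 a2]] [r2 [b1 b2]]; apply: (@row_inj r).
  by rewrite -a2 -b2; congr M; apply: (@col_inj c); rewrite a1 b1.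
have f_spec x : x != c -> [/\ f x != c, f x != x & f (f x) = x].
  move=> nxc; move: (nxc); rewrite eq_sym => ne.
  have [r' [r'' [c3 comp]]] := completion r ne.
  have [_ /=] := completes3_uniq ne comp.
  rewrite !inE negb_or -andbA andbT => /and3P [_ n1 n2].
  have [e1 e2 e3 _ e5] := comp.
  have fx : f x = c3.
    by move: (fP x); rewrite (negPf nxc) => /Tinj; apply; exists r'.
  rewrite fx; split; rewrite 1?eq_sym //.
  (* Starting from column [c3], the row [r''] plays the part of [r']: the equations [e3] and [e5]
     say that [T c3 x] holds. *)
  move: (fP c3); rewrite eq_sym (negPf n1) => /Tinj; apply.
  by exists r''.
have fc : f c = c by move: (fP c); rewrite eqxx.
have fK : involutive f.
  by move=> x; case: (eqVneq x c) => [->|/f_spec []//]; rewrite !fc.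
(* The complement of [c] has cardinal [#|C|.-1]; since [C] contains [c], this is a true predecessor
   and its parity is opposite to that of [#|C|]. *)
suff: 2 %| #|predC1 c|.
  by rewrite cardC1 dvdn2; case: #|C| (fintype0 c).
rewrite -(@fcard_order_set _ f (inv_inj fK) 2 (predC1 c)) ?dvdn_mull //.
  apply/subsetP => x; rewrite !inE => /f_spec [_ nx ffx].
  rewrite (@order_cycle _ f [:: x; f x]) ?inE ?eqxx //= ?ffx ?eqxx //.
  by rewrite inE eq_sym nx.
move=> x _ /eqP <-; rewrite !inE; case: (eqVneq x c) => [->|/f_spec [-> //]].
by rewrite fc eqxx.
Qed.

End Completion.

Lemma odd_dvd3_mod6 n : odd n -> 3 %| n -> n = 3 %[mod 6].
Proof.
move=> odd_n dvd3; apply/eqP; rewrite -[6]/(2 * 3) chinese_remainder //.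
by rewrite !modn2 odd_n (eqP dvd3).
Qed.

(** * Van Rees quasigroups *)

Lemma quasigroup_inj (Q : Type) (op : Q -> Q -> Q) :
  quasigroup op -> (forall x, injective (op x)) /\ forall y, injective (op^~ y).
Proof. by case=> bl br; split=> z; apply: bij_inj. Qed.

Lemma van_rees_completion (Q : Type) (op : Q -> Q -> Q) :
    van_rees_quasigroup op ->
  forall r c1 c2, exists r' r'' c3, completes3 op r c1 c2 r' r'' c3.
Proof.
move=> [[bl br] exp3] r c1 c2.
have [ldiv ldivK divlK] := bl r; have [rdiv rdivK divrK] := br c1.
(* The principal isotope: dividing by [c1] on the right and by [r] on the left makes [op r c1]
   neutral. *)
pose opP x y := op (rdiv x) (ldiv y).
have loopP : loop opP (op r c1).
  split=> [|y|x]; last 2 first.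
  - by rewrite /opP rdivK divlK.
  - by rewrite /opP ldivK divrK.
  split=> x.
  - by apply: bij_comp (bl _) _; exists (op r).
  - by apply: (bij_comp (br (ldiv x))); exists (op^~ c1).
have isoP : isotopic op opP.
  exists (op^~ c1), (op r), id; split=> //; first by exists id.
  by move=> x y; rewrite /opP rdivK ldivK.
have {}exp3 := exp3 _ _ _ loopP isoP.
have [qP _ _] := loopP; have [_ injr] := quasigroup_inj qP.
set x := op r c2; set y := opP x x.
have xE : ldiv x = c2 by rewrite ldivK.
(* In the loop, [yy.y] and [x.xx = xy] are both neutral; cancel the right factor [y]. *)
have y2 : opP y y = x.
  by apply: (injr y); rewrite /= (exp3 y).1 (exp3 x).2.
(* The subsquare is the loop table of the neutral element, [x] and [y = xx], with rows pulled back
   by [rdiv] and columns by [ldiv]. *)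
exists (rdiv x), (rdiv y), (ldiv y); split.
- exact: divrK.
- by rewrite divlK -xE.
- by rewrite divlK divrK.
- by rewrite -xE; apply: (exp3 x).1.
- exact: y2.
Qed.

(** * Latin squares, in particular of order 3 *)

Section LatinSquare.

Variables (S : finType) (n : nat) (A : 'M[S]_n).
Hypothesis latinA : latin_square A.

Lemma mem_symbols i j : A i j \in symbols A.
Proof. exact: imset2_f. Qed.

Lemma latin_row_inj i : injective (A i).
Proof.
have /and3P [_ /forallP /(_ i) /forall_inP rows _] := latinA.
move=> j k e; have /cards1P [l El] := rows _ (mem_symbols i j).
by have /set1P -> : j \in [set l]; [|have /set1P -> : k \in [set l]];
  rewrite -?El ?inE ?e.
Qed.

Lemma latin_col_inj j : injective (A^~ j).
Proof.
have /and3P [_ _ /forallP /(_ j) /forall_inP cols] := latinA.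
move=> i k /= e; have /cards1P [l El] := cols _ (mem_symbols i j).
by have /set1P -> : i \in [set l]; [|have /set1P -> : k \in [set l]];
  rewrite -?El ?inE ?e.
Qed.

Lemma latin_row_onto i s : s \in symbols A -> exists j, A i j = s.
Proof.
have /and3P [_ /forallP /(_ i) /forall_inP rows _] := latinA.
move=> /rows /cards1P [j Ej]; exists j; apply/eqP.
by have := set11 j; rewrite -Ej inE.
Qed.

Lemma latin_col_onto j s : s \in symbols A -> exists i, A i j = s.
Proof.
have /and3P [_ _ /forallP /(_ j) /forall_inP cols] := latinA.
move=> /cols /cards1P [i Ei]; exists i; apply/eqP.
by have := set11 i; rewrite -Ei inE.
Qed.

End LatinSquare.

Lemma uniq_card_mem (T : finType) (s : seq T) (x : T) :
  uniq s -> size s = #|T| -> x \in s.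
Proof.
move=> us ss; have [||_ ->] := uniq_min_size us (s2 := enum T).
- by move=> y _; rewrite mem_enum.
- by rewrite -cardE ss.
- by rewrite mem_enum.
Qed.

Lemma latin3_completion (S : finType) (B : 'M[S]_3) (i j1 j2 : 'I_3) :
    latin_square B -> j1 != j2 ->
  exists i' i'' j3, completes3 B i j1 j2 i' i'' j3.
Proof.
move=> latinB ne.
have rI := latin_row_inj latinB; have cI := latin_col_inj latinB.
have [j3 n3] : exists j3, j3 \notin [:: j1; j2].
  apply/existsP; rewrite -negb_forall; apply/negP => /forallP sub.
  have := uniq_leq_size (enum_uniq 'I_3) (fun x _ => sub x).
  by rewrite size_enum_ord.
move: n3; rewrite !inE negb_or => /andP [n31 n32].
have allj k : k \in [:: j1; j2; j3].
  apply: uniq_card_mem; rewrite ?card_ord //=.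
  by rewrite !inE negb_or ne !(eq_sym _ j3) n31 n32.
have [i' e1] := latin_col_onto latinB j1 (mem_symbols B i j2).
have [i'' e3] := latin_col_onto latinB j1 (mem_symbols B i j3).
have ni : i != i'.
  by apply: contraNneq ne => ei; rewrite -ei in e1; rewrite (rI _ _ _ e1).
have ni2 : i != i''.
  by apply: contraNneq n31 => ei; rewrite -ei in e3; rewrite (rI _ _ _ e3).
have ni3 : i' != i''.
  by apply: contraNneq n32 => ei; apply/eqP/(rI i); rewrite -e1 -e3 ei.
have alli k : k \in [:: i; i'; i''].
  by apply: uniq_card_mem; rewrite ?card_ord //= !inE negb_or ni ni2 ni3.
(* Here and for [e4], [e5], the wanted symbol must occur in the line, and the other two cells are
   ruled out by known entries. *)
have e2 : B i' j2 = B i j3.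
  have [k ek] := latin_row_onto latinB i' (mem_symbols B i j3).
  have := allj k; rewrite !inE => /or3P [] /eqP Ek; rewrite Ek in ek => //.
    by rewrite e1 in ek; case/eqP: n32; rewrite (rI _ _ _ ek).
  by case/eqP: ni; rewrite (cI _ _ _ ek).
have e4 : B i'' j2 = B i j1.
  have [k ek] := latin_col_onto latinB j2 (mem_symbols B i j1).
  have := alli k; rewrite !inE => /or3P [] /eqP Ek; rewrite Ek in ek => //.
    by case/eqP: ne; rewrite (rI _ _ _ ek).
  by rewrite e2 in ek; case/eqP: n31; rewrite (rI _ _ _ ek).
have e5 : B i'' j3 = B i j2.
  have [k ek] := latin_row_onto latinB i'' (mem_symbols B i j2).
  have := allj k; rewrite !inE => /or3P [] /eqP Ek; rewrite Ek in ek => //.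
    by rewrite e3 in ek; case/eqP: n32; rewrite (rI _ _ _ ek).
  by rewrite e4 in ek; case/eqP: ne; rewrite (rI _ _ _ ek).
by exists i', i'', j3.
Qed.

Lemma increasing_inj k n (f : {ffun 'I_k -> 'I_n}) : increasing f -> injective f.
Proof.
move=> /forallP inc i j e; apply/val_inj/eqP; case: ltngtP => // lt.
- by have /forallP/(_ j)/implyP/(_ lt) := inc i; rewrite e ltnn.
- by have /forallP/(_ i)/implyP/(_ lt) := inc j; rewrite e ltnn.
Qed.

(** Strictly sorted lists with the same members are equal. Hence a submatrix is determined by its
    sets of rows and columns. *)
Lemma increasing_codom_eq k n (f g : {ffun 'I_k -> 'I_n}) :
  increasing f -> increasing g -> codom f =i codom g -> f = g.
Proof.
pose ltI (m : nat) := relpre (@nat_of_ord m) ltn.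
have sorted_codom (h : {ffun 'I_k -> 'I_n}) :
    increasing h -> sorted (ltI n) (codom h).
  move=> /forallP inc; apply: (@homo_sorted _ _ h (ltI k)) => [i j ltij|].
    by have /forallP/(_ j)/implyP/(_ ltij) := inc i.
  by rewrite -sorted_map val_enum_ord iota_ltn_sorted.
move=> /sorted_codom sf /sorted_codom sg eqfg.
have ltI_tr : transitive (ltI n) by move=> y x z; apply: ltn_trans.
have /eq_in_map efg : codom f = codom g.
  by apply: (irr_sorted_eq ltI_tr) => // x; rewrite /= ltnn.
by apply/ffunP => i; rewrite efg ?mem_enum.
Qed.

Lemma codom_uniq3 (T : finType) (f : 'I_3 -> T) i j k :
  uniq [:: i; j; k] -> codom f =i [:: f i; f j; f k].
Proof.
move=> u x; rewrite -[[:: f i; _; _]]/(map f [:: i; j; k]).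
apply/codomP/mapP => [[l ->]|[l _ ->]]; last by exists l.
by exists l => //; apply: uniq_card_mem; rewrite ?card_ord.
Qed.

(** * Counting triples in van Rees latin squares *)

Section VanReesSquare.

Variables (S : finType) (n : nat) (L : 'M[S]_n).
Hypothesis latinL : latin_square L.

Let rI := latin_row_inj latinL.
Let cI := latin_col_inj latinL.

Definition position (x : ({ffun 'I_3 -> 'I_n} * {ffun 'I_3 -> 'I_n}) *
    ('I_3 * ('I_3 * 'I_3))) : 'I_n * ('I_n * 'I_n) :=
  (x.1.1 x.2.1, (x.1.2 x.2.2.1, x.1.2 x.2.2.2)).

(** A row with two distinct columns. The case [m = k = 3] accounts for the factor 18, the case
    [m = k = n] for [n ^ 2 * (n - 1)]. *)
Definition off_diagonal (m k : nat) : {set 'I_m * ('I_k * 'I_k)} :=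
  [set x | x.2.1 != x.2.2].

Lemma card_off_diagonal m k : #|off_diagonal m k| = m * (k * (k - 1)).
Proof.
have -> : off_diagonal m k = setX setT (~: [set (x, x) | x : 'I_k]).
  apply/setP => -[i [x y]]; rewrite !inE /=; congr (~~ _).
  by apply/eqP/imsetP => [->|[z _ [-> ->]] //]; exists y.
rewrite cardsX cardsT card_ord cardsCs setCK card_imset; last by move=> x y [].
by rewrite card_prod card_ord (mulnBr k) muln1.
Qed.

(** Transports the completion inside the subsquare to [L]; the two [codom] clauses allow [p] to be
    recovered from a triple. *)
Lemma subsquare_completion p i j1 j2 :
    p \in subsquares 3 L -> j1 != j2 ->
  exists r' r'' c3,
    [/\ completes3 L (p.1 i) (p.2 j1) (p.2 j2) r' r'' c3,
        codom p.1 =i [:: p.1 i; r'; r''] &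
        codom p.2 =i [:: p.2 j1; p.2 j2; c3]].
Proof.
case: p => f g; rewrite inE /= => /and3P [_ _ latinB] ne.
have [i' [i'' [j3 comp]]] := latin3_completion i latinB ne.
have [ui uj] :=
  completes3_uniq (latin_row_inj latinB) (latin_col_inj latinB) ne comp.
exists (f i'), (f i''), (g j3); split; try exact: codom_uniq3.
by case: comp; rewrite !mxE; split.
Qed.

(** Two subsquares through the same triple have the same completion in [L], hence the same row and
    column sets, hence the same enumerations, which are injective on indices. *)
Lemma position_inj :
  {in setX (subsquares 3 L) (off_diagonal 3 3) &, injective position}.
Proof.
move=> [[f g] [i [j1 j2]]] [[f' g'] [i' [j1' j2']]] /setXP [/= p1 q1].
move=> /setXP [/= p2 q2] [ei ej1 ej2]; rewrite !inE /= in q1 q2.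
have [r1 [r2 [c3 [comp cf cg]]]] := subsquare_completion i p1 q1.
have [s1 [s2 [d3 [comp' cf' cg']]]] := subsquare_completion i' p2 q2.
rewrite /= in comp cf cg comp' cf' cg'.
rewrite -ei -ej1 -ej2 in comp' cf' cg'.
have [e1 e2 e3] := completes3_inj rI cI comp comp'.
rewrite -e1 -e2 -e3 in cf' cg'.
move: p1 p2; rewrite !inE /= => /and3P [incf incg _] /and3P [incf' incg' _].
have ef : f = f'.
  by apply: increasing_codom_eq => // x; rewrite cf cf'.
have eg : g = g'.
  by apply: increasing_codom_eq => // x; rewrite cg cg'.
rewrite -ef in ei; rewrite -eg in ej1 ej2; rewrite -ef -eg.
by rewrite (increasing_inj incf ei) (increasing_inj incg ej1)
  (increasing_inj incg ej2).
Qed.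

Lemma van_rees_square_completion r c1 c2 :
    18 * #|subsquares 3 L| = n ^ 2 * (n - 1) -> c1 != c2 ->
  exists r' r'' c3, completes3 L r c1 c2 r' r'' c3.
Proof.
move=> count ne; set X := setX (subsquares 3 L) (off_diagonal 3 3).
have sub : position @: X \subset off_diagonal n n.
  apply/subsetP => _ /imsetP [[[f g] [i [j1 j2]]] /setXP [/= p q] ->].
  move: p q; rewrite !inE /= => /and3P [_ incg _].
  by rewrite (inj_eq (increasing_inj incg)).
have /eqP EX : position @: X == off_diagonal n n.
  rewrite eqEcard sub card_in_imset; last exact: position_inj.
  rewrite cardsX !card_off_diagonal (mulnC #|_|) -[3 * _]/18 count.
  by rewrite mulnA mulnn leqnn.
have : (r, (c1, c2)) \in position @: X by rewrite EX inE.
case/imsetP => -[p [i [j1 j2]]] /setXP [/= pL]; rewrite inE => /= nej [-> -> ->].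
have [r' [r'' [c3 [comp _ _]]]] := subsquare_completion i pL nej.
by exists r', r'', c3.
Qed.

End VanReesSquare.

Theorem theorem4 (n : nat) (hn : 1 < n) :
  (forall (Q : finType) (op : Q -> Q -> Q),
     van_rees_quasigroup op -> #|Q| = n -> n = 3 %[mod 6]) /\
  (forall (S : finType) (L : 'M[S]_n),
     van_rees_latin_square L -> n = 3 %[mod 6]).
Proof.
split=> [Q op vrQ cardQ | S L [latinL count]].
  have [rI cI] := quasigroup_inj vrQ.1.
  have comp r c1 c2 (_ : c1 != c2) := van_rees_completion vrQ r c1 c2.
  (* The bound [hn] supplies the two distinct columns on which the 3-cycles of rows depend. *)
  have /card_gt1P [x [y [_ _ ne]]] : 1 < #|Q| by rewrite cardQ.
  rewrite -cardQ; apply: odd_dvd3_mod6.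
  - exact: (odd_card_columns rI cI comp x x).
  - exact: (dvd3_card_rows rI cI comp ne).
have rI := latin_row_inj latinL; have cI := latin_col_inj latinL.
have comp r c1 c2 :=
  van_rees_square_completion latinL r (c1 := c1) (c2 := c2) count.
have /card_gt1P [x [y [_ _ ne]]] : 1 < #|'I_n| by rewrite card_ord.
rewrite -(card_ord n); apply: odd_dvd3_mod6.
- exact: (odd_card_columns rI cI comp x x).
- exact: (dvd3_card_rows rI cI comp ne).
Qed.
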